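(* Let $\mathfrak{A}\subset B(\mathcal{H})$ be a unital $\mathrm{C}^*$-algebra and let $\mathfrak{J}\subset\mathfrak{A}$ be a closed two-sided ideal which is non-degenerate. Let $X\in B(\mathcal{H})$ be a positive trace class operator with $\operatorname{tr}X=1$, and let $\tau_X$ be the state on $\mathfrak{A}$ defined as $$\tau_X(a)=\operatorname{tr}(aX),\quad a\in\mathfrak{A}.$$ Then, $\tau_X$ has the unique extension property with respect to $\mathfrak{J}+\mathbb{C}I$.
   Context: A subset $\mathcal{D}\subset B(\mathcal{H})$ is non-degenerate if $\overline{\mathcal{D}\mathcal{H}}=\mathcal{H}$. A state $\chi$ on $\mathfrak{A}$ has the unique extension property with respect to a unital self-adjoint subspace $\mathfrak{S}\subset\mathfrak{A}$ if the only (completely) positive linear functional on $\mathfrak{A}$ extending $\chi|_{\mathfrak{S}}$ is $\chi$ itself. *)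

(* Defs.v *)
(* MathComp / MathComp-Analysis; complex scalars are R[i] over R : realType. *)
From HB Require Import structures.
From mathcomp Require Import all_boot all_order all_algebra.
From mathcomp Require Import complex.
From mathcomp Require Import all_classical all_reals all_analysis.

Set Implicit Arguments.
Unset Strict Implicit.
Unset Printing Implicit Defensive.

Import Order.TTheory GRing.Theory Num.Theory.
Import numFieldNormedType.Exports.

Local Open Scope classical_set_scope.
Local Open Scope ring_scope.

Definition linear_subspace (K : nzRingType) (L : lmodType K) (V : set L) : Prop :=
  V 0 /\ forall (c : K) (x y : L), V x -> V y -> V (c *: x + y).

Definition linear_span (K : nzRingType) (L : lmodType K) (S : set L) : set L :=
  smallest (@linear_subspace K L) S.

(* Operators are plain functions H -> H, added and scaled pointwise and
   multiplied by composition; functionals on a set of operators are functions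
   on H -> H of which only the values on that set matter.

   A Hilbert space is a complete normed space H over R[i] with an inner product
   dot (linear in its first argument) inducing the norm; the latter is
   [norm_from_dot dot]. *)
Section HilbertSpaceOperators.
Variables (R : realType) (H : completeNormedModType R[i]).
Variable dot : {dot H for Num.conj}.
Implicit Types (T S P X : H -> H) (A J D : set (H -> H)) (E : set H).
Implicit Types (phi chi : (H -> H) -> R[i]).

Definition norm_from_dot : Prop := forall x : H, `|x| ^+ 2 = dot x x.

Definition bounded_operator T : Prop :=
  linear T /\ exists M : R[i], forall x, `|T x| <= M * `|x|.

Definition adjoint_of T S : Prop := forall x y, dot (T x) y = dot x (S y).

(* As the scalars are complex, this forces a bounded T to be self-adjoint. *)
Definition positive_operator T : Prop := forall x, 0 <= dot (T x) x.

(* Closedness for the operator norm: the inner condition is ||T - S|| <= eps. *)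
Definition norm_closed A : Prop :=
  forall T, bounded_operator T ->
    (forall eps : R[i], 0 < eps ->
       exists2 S, A S & forall x, `|T x - S x| <= eps * `|x|) ->
    A T.

Definition unital_cstar_algebra A : Prop :=
  [/\ A `<=` bounded_operator,
      linear_subspace A /\ A idfun,
      (forall S T, A S -> A T -> A (S \o T)),
      (forall T, A T -> exists2 S, A S & adjoint_of T S) &
      norm_closed A].

Definition closed_two_sided_ideal A J : Prop :=
  [/\ J `<=` A,
      linear_subspace J,
      (forall S T, A S -> J T -> J (S \o T) /\ J (T \o S)) &
      norm_closed J].

(* D H is read as the linear span of the vectors T x, with T in D and x in H. *)
Definition nondegenerate_on D : Prop :=
  closure (linear_span [set y | exists T x, D T /\ y = T x]) = setT.

Definition orthonormal_basis E : Prop :=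
  [/\ (forall e, E e -> dot e e = 1),
      (forall e f, E e -> E f -> e <> f -> dot e f = 0) &
      closure (linear_span E) = setT].

(* Unordered summation: convergence to t of the net of sums over the finite
   subsets of E, which need not be countable. *)
Definition has_sum E (f : H -> R[i]) (t : R[i]) : Prop :=
  forall eps : R[i], 0 < eps ->
    exists2 F0, fsets E F0 &
      forall F, fsets E F -> F0 `<=` F -> `|\sum_(e \in F) f e - t| < eps.

(* P = |T|, the positive square root of T^* T. *)
Definition absolute_value T P : Prop :=
  [/\ bounded_operator P, positive_operator P &
      exists2 S, adjoint_of T S & P \o P = S \o T].

(* Since |T| >= 0, the condition does not depend on the basis. *)
Definition trace_class T : Prop :=
  bounded_operator T /\
  exists P E, [/\ absolute_value T P, orthonormal_basis E &
    (\esum_(e in E) (complex.Re (dot (P e) e))%:E < +oo)%E].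

(* The common value, over all orthonormal bases E, of the sums of <T e, e>;
   the default 0 is used only if there is no such value, which does not happen
   for trace class T. *)
Definition trace T : R[i] :=
  xget 0 [set t | forall E, orthonormal_basis E ->
                    has_sum E (fun e => dot (T e) e) t].

Definition trace_functional X : (H -> H) -> R[i] := fun a => trace (a \o X).

Definition positive_functional A phi : Prop :=
  (forall (c : R[i]) S T, A S -> A T -> phi (c *: S + T) = c * phi S + phi T) /\
  (forall T S, A T -> A S -> adjoint_of T S -> 0 <= phi (S \o T)).

Definition state A chi : Prop := positive_functional A chi /\ chi idfun = 1.

Definition unique_extension_property A (S : set (H -> H)) chi : Prop :=
  state A chi /\
  forall phi, positive_functional A phi ->
    (forall a, S a -> phi a = chi a) -> forall a, A a -> phi a = chi a.

Definition plus_scalars J : set (H -> H) :=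
  [set T | exists S (c : R[i]), J S /\ T = S + c *: (idfun : H -> H)].

End HilbertSpaceOperators.

Arguments bounded_operator {R H}.
Arguments norm_closed {R H}.
Arguments nondegenerate_on {R H}.
Arguments plus_scalars {R H}.

(* Main.v *)
Require Import Defs.
From HB Require Import structures.
From mathcomp Require Import all_boot all_order all_algebra.
From mathcomp Require Import complex ring.
From mathcomp Require Import all_classical all_reals all_analysis.
Import Order.TTheory GRing.Theory Num.Theory.
Import numFieldNormedType.Exports.
Local Open Scope classical_set_scope.
Local Open Scope ring_scope.

(** Two facts carry the proof.

The trace functional is an infinite sum of vector functionals.  A positive
operator [X] with summable diagonal is a series of rank one operators
[x |-> <x, w_k> w_k] with [sum_k |w_k|^2 <= tr X], by Cholesky elimination along
an orthonormal basis ([peel], [rank_one_series]).  Each step subtracts a rank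
one operator, leaves a positive residual, and makes the residual vanish at one
more basis vector, so the residuals tend weakly to [0].  It follows, by expanding in
any orthonormal basis and using domination by [|w_k|^2], that
[tr (a X) = sum_k <a w_k, w_k>] ([trace_functional_cvg]).

The ideal contains almost units for these vectors.  Call [g] a cutoff if it is
a contraction and [1 - g] lies in [J].  For [T] in [J] and [c >= |T|^2], the
powers of [1 - T T^* / c] are cutoffs, and they tend to [0] at every [T y],
because [sum_m |T D^m y|^2 <= c |y|^2] for [D = 1 - T^* T / c].  Cutoffs are
stable under composition, so non-degeneracy gives cutoffs that are small at
finitely many given vectors ([cutoff_family]), and domination gives cutoffs
with [sum_k |g w_k|^2] as small as desired ([cutoff_summable]).

Let now [phi] be a positive functional that agrees with [tau a = tr (a X)] on
[J + C 1].  Then [phi (g^* g) = tau (g^* g) = sum_k |g w_k|^2] is small, so by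
Cauchy-Schwarz [phi (a g)] and [tau (a g)] are small, whereas [a (1 - g)] lies
in [J], where the two functionals agree.  Hence [phi a = tau a]
([extension_unique_of_cutoffs]).  The equality at [g^* g] uses
[g^* g = g^* - g^* (1 - g)], whose last term is in [J], and
[phi g^* = conj (phi g)] ([agree_on_cutoff_square]). *)

Set Implicit Arguments.
Unset Strict Implicit.
Unset Printing Implicit Defensive.

(** * Sequences and series of complex numbers *)

Section ComplexSequences.
Variable R : realType.
Implicit Types (u v z b c : nat -> R[i]) (l m a eps : R[i]).

Definition converges_to u l : Prop := forall eps, 0 < eps ->
  exists N, forall n, (N <= n)%N -> `|u n - l| <= eps.

Lemma eq_of_dist_le l m : (forall eps, 0 < eps -> `|l - m| <= eps) -> l = m.
Proof.
move=> lm; apply/eqP; rewrite -subr_eq0 -normr_le0; apply/ler_addgt0Pr => eps e0.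
by rewrite add0r lm.
Qed.

Lemma converges_to_unique u l m : converges_to u l -> converges_to u m -> l = m.
Proof.
move=> ul um; apply: eq_of_dist_le => eps e0.
have e2 : 0 < eps / 2 by rewrite divr_gt0.
have [N hN] := ul _ e2; have [M hM] := um _ e2.
rewrite -(subrKA (u (maxn N M))) [leRHS]splitr.
rewrite (le_trans (ler_normD _ _))// lerD//; last by rewrite hM// leq_maxr.
by rewrite distrC hN// leq_maxl.
Qed.

Lemma converges_to_linear a u v l m : converges_to u l -> converges_to v m ->
  converges_to (fun n => a * u n + v n) (a * l + m).
Proof.
move=> ul vm eps e0.
have a1 : 0 < `|a| + 1 by rewrite ltr_wpDl.
have [N hN] := ul (eps / 2 / (`|a| + 1)) ltac:(by rewrite !divr_gt0).
have [M hM] := vm (eps / 2) ltac:(by rewrite divr_gt0).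
exists (maxn N M) => n; rewrite geq_max => /andP[/hN h1 /hM h2].
rewrite opprD addrACA -mulrBr [leRHS]splitr (le_trans (ler_normD _ _))// lerD//.
rewrite normrM (le_trans (ler_wpM2l _ h1))// mulrCA ler_piMr ?divr_ge0 ?(ltW e0)//.
by rewrite ler_pdivrMr// mul1r lerDl.
Qed.

Lemma converges_to_cst l : converges_to (fun=> l) l.
Proof. by move=> eps e0; exists 0 => n _; rewrite subrr normr0 ltW. Qed.

Lemma converges_to_sum (I : Type) (s : seq I) (f : I -> nat -> R[i])
    (g : I -> R[i]) : (forall i, converges_to (f i) (g i)) ->
  converges_to (fun n => \sum_(i <- s) f i n) (\sum_(i <- s) g i).
Proof.
move=> fg; elim: s => [|i s IH].
  by rewrite big_nil; under eq_fun do rewrite big_nil; apply: converges_to_cst.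
rewrite big_cons -[g i]mul1r.
under eq_fun do rewrite big_cons -[f i _]mul1r.
exact: converges_to_linear.
Qed.

Lemma converges_to_norm_le u l a :
  converges_to u l -> (forall n, `|u n| <= a) -> `|l| <= a.
Proof.
move=> ul ua; apply/ler_addgt0Pr => eps eps0.
have [N /(_ N (leqnn N)) hN] := ul eps eps0.
rewrite -[l](subKr (u N)) (le_trans (ler_normB _ _))// lerD//.
Qed.

(** The order of [R[i]] is partial, so a limit of nonnegative numbers has to be
shown to be real: it is the limit of the norms, hence equal to its norm. *)
Lemma converges_to_ge0 u l :
  converges_to u l -> (forall n, 0 <= u n) -> 0 <= l.
Proof.
move=> ul u0; suff -> : l = `|l| by [].
apply: eq_of_dist_le => eps e0.
have [N /(_ N (leqnn N)) hN] := ul (eps / 2) ltac:(by rewrite divr_gt0).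
rewrite -(subrKA (u N)) [leRHS]splitr (le_trans (ler_normD _ _))// lerD//.
  by rewrite distrC.
by rewrite -{1}(ger0_norm (u0 N)) (le_trans (ler_dist_dist _ _)).
Qed.

Lemma converges_to_complex u (x y : R) :
  (fun n => complex.Re (u n)) @ \oo --> x ->
  (fun n => complex.Im (u n)) @ \oo --> y ->
  converges_to u (Complex x y).
Proof.
move=> /cvgrPdist_le ux /cvgrPdist_le uy; move=> eps eps0.
have [r epsE] : exists r, eps = r%:C%C.
  by apply/complex_realP; rewrite gtr0_real.
have r0 : 0 < r / 2 by rewrite divr_gt0// -ltcR -epsE.
have [N1 _ hN1] := ux _ r0; have [N2 _ hN2] := uy _ r0.
exists (maxn N1 N2) => n; rewrite geq_max => /andP[/hN1/= h1 /hN2/= h2].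
rewrite distrC; case: (u n) h1 h2 => a b /= h1 h2.
have -> : Complex x y - Complex a b = (x - a)%:C%C + 'i%C * (y - b)%:C%C.
  by simpc.
apply: le_trans (ler_normD _ _) _; rewrite normrM.
have -> : `|'i%C : R[i]| = 1 by rewrite normc_def /= expr0n expr1n add0r sqrtr1.
rewrite mul1r !normc_def /= expr0n !addr0 !sqrtr_sqr -rmorphD epsE lecR.
by rewrite [leRHS](splitr r) lerD.
Qed.

Lemma invn_small (eps : R[i]) : 0 < eps -> exists n, n.+1%:R^-1 <= eps.
Proof.
move=> eps0; have [r epsE] : exists r, eps = r%:C%C.
  by apply/complex_realP; rewrite gtr0_real.
have r0 : 0 < r by rewrite -ltcR -epsE.
have [n hn] := ltr_add_invr r0; exists n.
by rewrite epsE -(rmorph_nat (real_complex R)) -fmorphV lecR ltW// -[ltLHS]add0r.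
Qed.

Lemma complex_series_cvg z a : (forall n, \sum_(k < n) `|z k| <= a) ->
  exists l, converges_to (fun n => \sum_(k < n) z k) l.
Proof.
move=> za.
have part (f : R[i] -> R) : f 0 = 0 -> {morph f : x y / x + y} ->
    (forall x, `|f x|%:C%C <= `|x|) ->
    exists x : R, (fun n => f (\sum_(k < n) z k)) @ \oo --> x.
  move=> f0 fD fn.
  have -> : (fun n => f (\sum_(k < n) z k)) = series (fun k => f (z k)).
    by apply/funext => n; rewrite (big_morph f fD f0) seriesEord.
  suff : cvgn (series (fun k => f (z k))) by exists (limn (series (fun k => f (z k)))).
  apply: normed_cvg; apply: nondecreasing_is_cvgn.
    by apply: nondecreasing_series => n _ _; rewrite normr_ge0.
  exists (complex.Re a) => _ [n _ <-].
  rewrite -[leLHS]/(series (fun k => `|f (z k)|) n) seriesEord.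
  have : (\sum_(k < n) `|f (z k)|)%:C%C <= a.
    apply: le_trans (za n); rewrite rmorph_sum.
    by apply: ler_sum => k _; apply: fn.
  by rewrite lecE => /andP[].
have [x hx] : exists x : R, (fun n => complex.Re (\sum_(k < n) z k)) @ \oo --> x.
  apply: part => //; first by case=> ? ? [].
  exact: normc_ge_Re.
have [y hy] : exists y : R, (fun n => complex.Im (\sum_(k < n) z k)) @ \oo --> y.
  apply: part => //; first by case=> ? ? [].
  move=> w; have := normc_ge_Re (w * 'i%C); rewrite ReiNIm normrN normrM.
  have -> : `|'i%C : R[i]| = 1.
    by rewrite normc_def /= expr0n expr1n add0r sqrtr1.
  by rewrite mulr1.
by exists (Complex x y); apply: converges_to_complex.
Qed.

(** Dominated convergence in the form of an a priori choice: to make all the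
partial sums of a family dominated by [b] small, it suffices to make finitely
many terms small, and how many and how small depends only on [b] and [eps]. *)
Lemma dominated_sum b a eps : (forall k, 0 <= b k) ->
    (forall n, \sum_(k < n) b k <= a) -> 0 < eps ->
  exists N, exists2 d, 0 < d & forall c, (forall k, 0 <= c k <= b k) ->
    (forall k, (k < N)%N -> c k <= d) -> forall n, \sum_(k < n) c k <= eps.
Proof.
move=> b0 ba eps0.
have [l] : exists l, converges_to (fun n => \sum_(k < n) b k) l.
  by apply: (@complex_series_cvg _ a) => n; under eq_bigr do rewrite ger0_norm//.
have e4 : 0 < eps / 2 / 2 by rewrite !divr_gt0.
move=> /(_ _ e4)[N hN].
exists N, (eps / 2 / N.+1%:R); first by rewrite !divr_gt0.
move=> c cb cN n; apply: (@le_trans _ _ (\sum_(k < N + n) c k)).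
  rewrite -[leRHS](big_mkord xpredT c) -[leLHS](big_mkord xpredT c).
  rewrite (@big_cat_nat _ _ _ n 0 (N + n)) ?leq_addl//= lerDl.
  by apply: sumr_ge0 => k _; have /andP[] := cb k.
rewrite -[leLHS](big_mkord xpredT c) (@big_cat_nat _ _ _ N 0 (N + n)) ?leq_addr//=.
rewrite [leRHS]splitr lerD//.
  apply: (@le_trans _ _ (\sum_(0 <= k < N) (eps / 2 / N.+1%:R))).
    by rewrite !big_mkord; apply: ler_sum => k _; apply: cN.
  rewrite sumr_const_nat subn0 -[leLHS]mulr_natr mulrAC ler_pdivrMr ?ltr0Sn//.
  by rewrite ler_wpM2l ?ler_nat// divr_ge0// ltW.
apply: (@le_trans _ _ (\sum_(N <= k < N + n) b k)).
  by apply: ler_sum => k _; have /andP[] := cb k.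
have -> : \sum_(N <= k < N + n) b k = `|\sum_(N <= k < N + n) b k|.
  by rewrite ger0_norm//; apply: sumr_ge0.
have -> : \sum_(N <= k < N + n) b k =
    (\sum_(k < N + n) b k - l) - (\sum_(k < N) b k - l).
  rewrite opprB addrA subrK -!(big_mkord xpredT b).
  by rewrite (@big_cat_nat _ _ _ N 0 (N + n)) ?leq_addr//= addrAC subrr add0r.
by rewrite (le_trans (ler_normB _ _))// [leRHS]splitr lerD// hN ?leq_addr.
Qed.

Lemma small_term b a eps : (forall k, 0 <= b k) ->
    (forall n, \sum_(k < n) b k <= a) -> 0 < eps -> exists k, b k <= eps.
Proof.
move=> b0 ba eps0; have [N [d d0 dom]] := dominated_sum b0 ba eps0.
(* Domination also applies to the family that keeps only the terms from [N] on. *)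
exists N; pose c k := if (k < N)%N then 0 else b k.
apply: le_trans (dom c _ _ N.+1).
- by rewrite big_ord_recr /= {2}/c ltnn lerDr sumr_ge0// => k _; rewrite /c ltn_ord.
- by move=> k; rewrite /c; case: ifP => _; rewrite lexx b0.
- by move=> k kN; rewrite /c kN ltW.
Qed.

(** The scalar core of every Cauchy-Schwarz inequality below.  The values
[c = 1] and [c = 'i] force [r = q^*].  Then [c = - t q^*] gives
[0 <= p - 2 t |q|^2 + t^2 |q|^2 s] for all [t >= 0]: the choice [t = 1 / s] is
the inequality, and if [s = 0] a large [t] is possible only for [q = 0]. *)
Lemma ge0_sesquilinear (p q r s : R[i]) : 0 <= p -> 0 <= s ->
    (forall c : R[i], 0 <= p + c * q + c^* * r + `|c| ^+ 2 * s) ->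
  r = q^* /\ `|q| ^+ 2 <= p * s.
Proof.
move=> p0 s0 h.
have realC (x : R[i]) : 0 <= x -> x^* = x by move=> x0; rewrite geC0_conj.
have rE : r = q^*.
  have hx (c : R[i]) : c^* * q^* + c * r^* = c * q + c^* * r.
    have := h c; have : 0 <= `|c| ^+ 2 by rewrite exprn_ge0.
    move: (`|c| ^+ 2) => d d0 /realC.
    have -> : (p + c * q + c^* * r + d * s)^* =
        p + (c^* * q^* + c * r^*) + d * s.
      by rewrite !rmorphD !rmorphM /= conjCK (realC _ p0) (realC _ s0) (realC _ d0) addrA.
    by move/addIr; rewrite -addrA => /addrI.
  have := hx 1; rewrite rmorph1 !mul1r => h1.
  have := hx 'i; rewrite conjCi !mulNr addrC -!mulrBr.
  move/(mulfI (neq0Ci R[i])) => hi.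
  have : q^* * 2 = r * 2.
    have -> : q^* * 2 = q^* + r^* - (r^* - q^*) by ring.
    by rewrite h1 hi; ring.
  by move=> h2; apply/esym/(mulIf _ h2); rewrite pnatr_eq0.
split=> //; rewrite {}rE in h.
set m := `|q| ^+ 2; have m0 : 0 <= m by rewrite exprn_ge0.
have key t : 0 <= t -> 0 <= p - t * m *+ 2 + t ^+ 2 * m * s.
  move=> t0; have := h (- (t * q^*)).
  rewrite rmorphN rmorphM /= conjCK (realC _ t0) normrN normrM (ger0_norm t0).
  rewrite norm_conjC exprMn /m normCK => /le_trans; apply.
  by rewrite le_eqVlt; apply/orP; left; apply/eqP; ring.
have [s_0|s_n0] := eqVneq s 0.
  rewrite s_0 mulr0 real_leNgt ?ger0_real//; apply/negP => m_gt0.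
  have t0 : 0 <= (p + 1) / (m *+ 2).
    by rewrite divr_ge0 ?addr_ge0// mulrn_wge0.
  have := key _ t0; rewrite s_0 mulr0 addr0 -mulrnAr mulfVK; last first.
    by rewrite mulrn_eq0 /= gt_eqF.
  by rewrite opprD addrA subrr add0r oppr_ge0 ler10.
have s_gt0 : 0 < s by rewrite lt_def s_n0.
have t0 : 0 <= s^-1 by rewrite invr_ge0.
have := key _ t0.
have -> : p - s^-1 * m *+ 2 + s^-1 ^+ 2 * m * s = p - m / s by field.
by rewrite subr_ge0 ler_pdivrMr.
Qed.

End ComplexSequences.

(** * Inner products and bounded operators *)

Section HilbertSpace.
Variables (R : realType) (H : completeNormedModType R[i]).
Variable dot : {dot H for Num.conj}.
Hypothesis dot_norm : norm_from_dot dot.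
Implicit Types (T S : H -> H) (E F : set H) (u v w x y : H).

Lemma dotC x y : dot x y = (dot y x)^*.
Proof. by rewrite hermC expr0 mul1r. Qed.

Lemma dotDl x y v : dot (x + y) v = dot x v + dot y v.
Proof. exact: linearDl. Qed.

Lemma dotDr x y v : dot v (x + y) = dot v x + dot v y.
Proof. exact: linearDr. Qed.

Lemma dotBl x y v : dot (x - y) v = dot x v - dot y v.
Proof. exact: linearBl. Qed.

Lemma dotBr x y v : dot v (x - y) = dot v x - dot v y.
Proof. exact: linearBr. Qed.

Lemma dotNl x v : dot (- x) v = - dot x v.
Proof. exact: linearNl. Qed.

Lemma dotNr x v : dot v (- x) = - dot v x.
Proof. exact: linearNr. Qed.

Lemma dotZl (a : R[i]) x v : dot (a *: x) v = a * dot x v.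
Proof. exact: linearZl_LR. Qed.

Lemma dotZr (a : R[i]) x v : dot v (a *: x) = a^* * dot v x.
Proof. exact: linearZr_LR. Qed.

Lemma dot0l x : dot 0 x = 0.
Proof. exact: linear0l. Qed.

Lemma dot0r x : dot x 0 = 0.
Proof. exact: linear0r. Qed.

Lemma dot_suml (I : Type) (s : seq I) (f : I -> H) v :
  dot (\sum_(i <- s) f i) v = \sum_(i <- s) dot (f i) v.
Proof. exact: (big_morph (dot^~ v) (fun x y => dotDl x y v) (dot0l v)). Qed.

Definition dotE := (dotDl, dotDr, dotNl, dotNr, dotZl, dotZr).

(** Replaces a linear function by a bundled one, to which the library of linear
maps applies. *)
Lemma linear_operator T : linear T -> exists f : {linear H -> H}, T = f.
Proof.
move=> hT; pose m := GRing.isLinear.Build _ _ _ _ T hT.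
by exists (HB.pack_for {linear H -> H} T m).
Qed.

(** Cauchy-Schwarz for the form [<T x, y>]; as the scalars are complex,
positivity also makes it hermitian. *)
Lemma positive_operator_form T : linear T -> positive_operator dot T ->
  forall x y, dot (T x) y = dot x (T y) /\
    `|dot (T x) y| ^+ 2 <= dot (T x) x * dot (T y) y.
Proof.
move=> /linear_operator[f ->] fpos x y.
have [|rE qle] := @ge0_sesquilinear R _ (dot (f y) x) (dot (f x) y) _
    (fpos x) (fpos y).
  move=> c; have := fpos (x + c *: y).
  rewrite (linearD f) (linearZ_LR f) !dotE normCK => /le_trans; apply.
  by rewrite le_eqVlt; apply/orP; left; apply/eqP; ring.
by split; [rewrite rE -dotC | rewrite rE norm_conjC].
Qed.

Lemma dot_le_norm x y : `|dot x y| <= `|x| * `|y|.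
Proof.
have idpos : positive_operator dot idfun by move=> v; rewrite -dot_norm exprn_ge0.
have [//|_] := positive_operator_form _ idpos x y.
by rewrite -!dot_norm -exprMn ler_sqr ?nnegrE ?mulr_ge0.
Qed.

Lemma norm_pythagoras u v : dot u v = 0 -> `|u + v| ^+ 2 = `|u| ^+ 2 + `|v| ^+ 2.
Proof.
by move=> uv; rewrite !dot_norm !dotE uv [dot v u]dotC uv rmorph0 addr0 add0r.
Qed.

Lemma bounded_operatorP T : bounded_operator T ->
  linear T /\ exists2 M : R[i], 0 < M & forall x, `|T x| <= M * `|x|.
Proof.
move=> [Tlin [M hM]]; split => //; exists (`|M| + 1); first by rewrite ltr_wpDl.
move=> x; apply: le_trans (_ : `|M| * `|x| <= _).
  by rewrite -[`|x|]normr_id -normrM ger0_norm ?hM// (le_trans _ (hM x)).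
by rewrite ler_wpM2r// lerDl.
Qed.

Lemma adjoint_sym T S : adjoint_of dot T S -> adjoint_of dot S T.
Proof. by move=> TS x y; rewrite dotC -TS -dotC. Qed.

Lemma adjoint_bound T S (M : R[i]) : adjoint_of dot T S -> 0 < M ->
  (forall x, `|T x| <= M * `|x|) -> forall x, `|S x| <= M * `|x|.
Proof.
move=> TS M0 hM x; have [->|Sx0] := eqVneq (S x) 0.
  by rewrite normr0 mulr_ge0// ltW.
have Sx_gt0 : 0 < `|S x| by rewrite normr_gt0.
rewrite -(ler_pM2l Sx_gt0) -expr2 dot_norm -TS -[dot _ _]ger0_norm; last first.
  by rewrite TS -dot_norm exprn_ge0.
by rewrite (le_trans (dot_le_norm _ _))// mulrA [`|S x| * M]mulrC ler_wpM2r.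
Qed.

Lemma closure_norm E x : closure E x ->
  forall eps : R[i], 0 < eps -> exists2 y, E y & `|x - y| <= eps.
Proof.
move=> Ex eps eps0; have /Ex[y [Ey]] : nbhs x (ball x eps) by exact: nbhsx_ballx.
by rewrite -ball_normE /= => /ltW xy; exists y.
Qed.

(** The density argument behind the three convergence results: of projections
onto a basis, of residuals, and of cutoffs. *)
Lemma dense_span_ind E (P : set H) : closure (linear_span E) = setT ->
    E `<=` P -> linear_subspace P ->
    (forall x, (forall eps : R[i], 0 < eps ->
      exists2 y, P y & `|x - y| <= eps) -> P x) ->
  forall x, P x.
Proof.
move=> Edense EP Psub Pclosed x; apply: Pclosed => eps eps0.
have : closure (linear_span E) x by rewrite Edense.
move=> /closure_norm/(_ _ eps0)[y Ey xy]; exists y => //.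
exact: (smallest_sub Psub EP).
Qed.

(** * Orthonormal bases *)

Definition proj F v := \sum_(e \in F) dot v e *: e.

Lemma projE F v : finite_set F ->
  proj F v = \sum_(e <- finmap.enum_fset (fset_set F)) dot v e *: e.
Proof. by move=> Ffin; rewrite /proj fsbig_finite. Qed.

Lemma proj_linear F : finite_set F -> linear (proj F).
Proof.
move=> Ffin a u v; rewrite !projE// scaler_sumr -big_split.
by apply: eq_bigr => e _; rewrite /= !dotE scalerDl scalerA.
Qed.

Lemma dot_proj F v w : finite_set F ->
  dot (proj F v) w = \sum_(e <- finmap.enum_fset (fset_set F)) dot v e * dot e w.
Proof.
by move=> Ffin; rewrite projE// dot_suml; under eq_bigr do rewrite dotZl.
Qed.

Section Basis.
Variable E : set H.
Hypothesis E_basis : orthonormal_basis dot E.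

Lemma dot_proj_in F v e : fsets E F -> F e -> dot (proj F v) e = dot v e.
Proof.
move=> [Ffin FE] Fe; have [E1 Eo _] := E_basis; rewrite dot_proj//.
have e_in : e \in finmap.enum_fset (fset_set F) by rewrite in_fset_set// inE.
rewrite (bigD1_seq e) ?finmap.fset_uniq//= (E1 _ (FE _ Fe)) mulr1.
rewrite big_seq_cond big1 ?addr0// => f /andP[].
rewrite in_fset_set// inE => Ff /eqP fe.
by rewrite (Eo f e (FE _ Ff) (FE _ Fe) fe) mulr0.
Qed.

Lemma norm_proj_sqr F v : fsets E F -> `|proj F v| ^+ 2 = dot (proj F v) v.
Proof.
move=> EF; have [Ffin _] := EF; rewrite dot_norm !dot_proj// !big_seq.
apply: eq_bigr => e; rewrite in_fset_set// inE => Fe; congr (_ * _).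
by rewrite dotC dot_proj_in// -dotC.
Qed.

Lemma proj_pythagoras F v : fsets E F ->
  `|v| ^+ 2 = `|v - proj F v| ^+ 2 + `|proj F v| ^+ 2.
Proof.
move=> EF; have [Ffin _] := EF.
rewrite -norm_pythagoras ?subrK// dotC dotBr -norm_proj_sqr// -dot_norm.
by rewrite subrr rmorph0.
Qed.

(** Applied to [x - y], this makes the set of vectors that are recovered by
[proj] closed; it is also the domination used for the trace. *)
Lemma norm_sub_proj_le F v : fsets E F -> `|v - proj F v| <= `|v|.
Proof.
move=> EF; rewrite -ler_sqr ?nnegrE// (proj_pythagoras v EF) lerDl.
by rewrite exprn_ge0.
Qed.

Lemma fsetsU F1 F2 : fsets E F1 -> fsets E F2 -> fsets E (F1 `|` F2).
Proof. by move=> [f1 s1] [f2 s2]; split; [rewrite finite_setU | rewrite subUset]. Qed.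

Lemma fsets0 : fsets E set0.
Proof. by split. Qed.

Lemma proj_cvg v (eps : R[i]) : 0 < eps ->
  exists2 F0, fsets E F0 &
    forall F, fsets E F -> F0 `<=` F -> `|v - proj F v| <= eps.
Proof.
have [_ _ E_dense] := E_basis; move: v eps.
apply: (dense_span_ind (P := fun v => forall eps : R[i], 0 < eps -> _) E_dense).
- move=> e Ee eps eps0; exists [set e].
    by split; [exact: finite_set1 | move=> _ ->].
  move=> F EF eF; have [Ffin FE] := EF.
  suff -> : proj F e = e by rewrite subrr normr0 ltW.
  have [E1 Eo _] := E_basis; rewrite projE//.
  have e_in : e \in finmap.enum_fset (fset_set F) by rewrite in_fset_set// inE; apply: eF.
  rewrite (bigD1_seq e) ?finmap.fset_uniq//= E1// scale1r.
  rewrite big_seq_cond big1 ?addr0// => f /andP[].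
  rewrite in_fset_set// inE => Ff /eqP fe.
  by rewrite (Eo e f Ee (FE _ Ff) (nesym fe)) scale0r.
- split.
    move=> eps eps0; exists set0 => [|F [Ffin _] _]; first exact: fsets0.
    have [f ->] := linear_operator (proj_linear Ffin).
    by rewrite (linear0 f) subrr normr0 ltW.
  move=> c x y hx hy eps eps0.
  have c1 : 0 < `|c| + 1 by rewrite ltr_wpDl.
  have [F1 EF1 h1] := hx (eps / 2 / (`|c| + 1)) ltac:(by rewrite !divr_gt0).
  have [F2 EF2 h2] := hy (eps / 2) ltac:(by rewrite divr_gt0).
  exists (F1 `|` F2) => [|F EF]; first exact: fsetsU.
  rewrite subUset => -[F1F F2F]; have [Ffin _] := EF.
  rewrite proj_linear// opprD addrACA -scalerBr [leRHS]splitr.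
  rewrite (le_trans (ler_normD _ _))// lerD ?h2//.
  rewrite normrZ (le_trans (ler_wpM2l _ (h1 _ EF F1F)))//.
  rewrite mulrCA ler_piMr ?divr_ge0 ?(ltW eps0)//.
  by rewrite ler_pdivrMr// mul1r lerDl.
- move=> x hx eps eps0; have e2 : 0 < eps / 2 by rewrite divr_gt0.
  have [y hy xy] := hx _ e2; have [F0 EF0 h] := hy _ e2.
  exists F0 => // F EF F0F; have [Ffin _] := EF.
  have -> : x - proj F x = (x - y - proj F (x - y)) + (y - proj F y).
    have [f ->] := linear_operator (proj_linear Ffin).
    by rewrite (linearB f) addrACA subrK -opprD subrK.
  rewrite (le_trans (ler_normD _ _))// [leRHS]splitr lerD ?h//.
  by rewrite (le_trans (norm_sub_proj_le _ EF)).
Qed.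

Lemma proj_cvg_family (v : nat -> H) (N : nat) (eps : R[i]) : 0 < eps ->
  exists2 F0, fsets E F0 & forall F, fsets E F -> F0 `<=` F ->
    forall k, (k < N)%N -> `|v k - proj F (v k)| <= eps.
Proof.
move=> eps0; elim: N => [|N [F1 EF1 h1]].
  by exists set0 => //; exact: fsets0.
have [F2 EF2 h2] := proj_cvg (v N) eps0.
exists (F1 `|` F2) => [|F EF]; first exact: fsetsU.
rewrite subUset => -[F1F F2F] k; rewrite ltnS leq_eqVlt => /predU1P[->|kN].
  exact: h2.
exact: h1.
Qed.

Lemma has_sum_unique (f : H -> R[i]) (s t : R[i]) :
  has_sum E f s -> has_sum E f t -> s = t.
Proof.
move=> fs ft; apply: eq_of_dist_le => eps eps0.
have e2 : 0 < eps / 2 by rewrite divr_gt0.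
have [F1 EF1 h1] := fs _ e2; have [F2 EF2 h2] := ft _ e2.
rewrite -(subrKA (\sum_(e \in F1 `|` F2) f e)) [leRHS]splitr.
rewrite (le_trans (ler_normD _ _))// lerD//; last first.
  by rewrite ltW// h2//; exact: fsetsU.
by rewrite distrC ltW// h1//; exact: fsetsU.
Qed.

End Basis.
End HilbertSpace.

(** * Positive operators of finite trace as rank one series *)

Section RankOneSeries.
Variables (R : realType) (H : completeNormedModType R[i]).
Variable dot : {dot H for Num.conj}.
Hypothesis dot_norm : norm_from_dot dot.
Implicit Types (T : H -> H) (E F : set H) (x y : H).

Lemma has_sum_ge E F (f : H -> R[i]) (t : R[i]) : 0 <= t ->
  (forall e, 0 <= f e) -> has_sum E f t -> fsets E F -> \sum_(e \in F) f e <= t.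
Proof.
move=> t0 f0 ft EF; apply/ler_addgt0Pr => eps eps0.
have [F0 EF0 h] := ft _ eps0.
have {h} h := h _ (fsetsU EF EF0) (@subsetUr _ _ _).
have UF : finite_set (F `|` F0).
  by rewrite finite_setU; split; [exact: (proj1 EF) | exact: (proj1 EF0)].
apply: (@le_trans _ _ (\sum_(e \in F `|` F0) f e)).
  by rewrite [leRHS](fsbigID F)// setUK lerDl; apply: fsumr_ge0.
rewrite -lerBlDl (le_trans _ (ltW h))// real_ler_norm// rpredB ?ger0_real//.
exact: fsumr_ge0.
Qed.

(** A summable family of nonnegative numbers is carried by a sequence: the
indices outside the finite sets that witness summability up to [1/(n+1)]
contribute nothing. *)
Lemma has_sum_support E (f : H -> R[i]) (t : R[i]) :
    (forall e, 0 <= f e) -> has_sum E f t ->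
  exists s : nat -> H, forall e, E e -> f e <> 0 -> exists k, s k = e.
Proof.
move=> f0 ft.
have /choice[G hG] : forall n, exists F0, fsets E F0 /\
    forall F, fsets E F -> F0 `<=` F -> `|\sum_(e \in F) f e - t| < n.+1%:R^-1.
  move=> n; have [|F0 EF0 h] := ft n.+1%:R^-1; first by rewrite invr_gt0 ltr0Sn.
  by exists F0.
pose g n := finmap.enum_fset (fset_set (G n)).
(* The finite sets are listed one after the other: [k] encodes a pair of a set
and a position in it. *)
exists (fun k => if unpickle k is Some (n, i) then nth 0 (g n) i else 0).
move=> e Ee fe0.
have [[n Gne]|noG] := pselect (exists n, G n e).
  have [[Gfin _] _] := hG n.
  have e_in : e \in g n by rewrite in_fset_set// inE.
  by exists (pickle (n, index e (g n))); rewrite pickleK nth_index.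
exfalso; apply: fe0; apply: eq_of_dist_le => eps eps0.
have e2 : 0 < eps / 2 by rewrite divr_gt0.
have [n hn] := invn_small e2.
apply: le_trans (_ : n.+1%:R^-1 + n.+1%:R^-1 <= _); last first.
  by rewrite [leRHS]splitr lerD.
have [EG h] := hG n; have [Gfin _] := EG.
have E1 : fsets E [set e] by split; [exact: finite_set1 | move=> _ ->].
have -> : f e - 0 = (\sum_(x \in G n `|` [set e]) f x - t) - (\sum_(x \in G n) f x - t).
  rewrite fsbigU//; last by move=> x [Gx xe]; case: noG; exists n; rewrite -xe.
  by rewrite fsbig_set1 opprB addrA subrK addrAC subrr add0r subr0.
rewrite (le_trans (ler_normB _ _))// lerD// ltW// h//.
exact: fsetsU.
Qed.

Lemma positive_operator_eq0 T x : linear T -> positive_operator dot T ->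
  dot (T x) x = 0 -> T x = 0.
Proof.
move=> Tlin Tpos Tx0; have [_] := positive_operator_form Tlin Tpos x (T x).
rewrite Tx0 mul0r -dot_norm => h.
have : `|T x| ^+ 2 == 0.
  by rewrite -sqrf_eq0 -[X in X ^+ 2 == 0]ger0_norm ?exprn_ge0// eq_le h exprn_ge0.
by rewrite sqrf_eq0 normr_eq0 => /eqP.
Qed.

(** One step of Cholesky elimination: the Schur complement of [T] with respect
to the line spanned by [e].  A zero pivot leaves [T] unchanged, which is right
since [T e = 0] in that case. *)
Definition peel T e x := T x - (dot x (T e) / dot (T e) e) *: T e.

Lemma dot_peel T e x y : dot (peel T e x) y =
  dot (T x) y - dot x (T e) * dot (T e) y / dot (T e) e.
Proof. by rewrite /peel dotBl dotZl mulrAC. Qed.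

Lemma peel_linear T e : linear T -> linear (peel T e).
Proof.
move=> /linear_operator[f ->] a x y; rewrite /peel linearP !dotE mulrDl scalerDl.
by rewrite opprD addrACA scalerBr scalerA mulrA.
Qed.

(** Cauchy-Schwarz for the form of [T] at [x] and [e]. *)
Lemma peel_positive T e : linear T -> positive_operator dot T ->
  positive_operator dot (peel T e).
Proof.
move=> Tlin Tpos x; rewrite dot_peel.
have [sym cs] := positive_operator_form Tlin Tpos x e.
rewrite [dot (T e) x]dotC -sym -normCK.
have [->|de] := eqVneq (dot (T e) e) 0; first by rewrite invr0 mulr0 subr0.
by rewrite subr_ge0 ler_pdivrMr// lt_def de Tpos.
Qed.

Lemma peel_kernel T e x : linear T -> positive_operator dot T ->
  T x = 0 -> peel T e x = 0.
Proof.
move=> Tlin Tpos Tx0; have [sym _] := positive_operator_form Tlin Tpos x e.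
by rewrite /peel Tx0 -sym Tx0 dot0l mul0r scale0r subr0.
Qed.

Lemma peel_pivot T e : linear T -> positive_operator dot T -> peel T e e = 0.
Proof.
move=> Tlin Tpos; have [sym _] := positive_operator_form Tlin Tpos e e.
rewrite /peel -sym; have [de|de] := eqVneq (dot (T e) e) 0.
  by rewrite (positive_operator_eq0 Tlin Tpos de) scaler0 subr0.
by rewrite divff// scale1r subrr.
Qed.

(** The normalization for which the step subtracts exactly
[x |-> <x, v> v]; for a zero pivot it yields the zero vector. *)
Definition pivot_vector T e := (sqrtC (dot (T e) e))^-1 *: T e.

Lemma dot_pivot_vector T e x y : positive_operator dot T ->
  dot x (pivot_vector T e) * dot (pivot_vector T e) y =
    dot x (T e) * dot (T e) y / dot (T e) e.
Proof.
move=> Tpos; rewrite /pivot_vector !dotE.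
have -> : ((sqrtC (dot (T e) e))^-1)^* = (sqrtC (dot (T e) e))^-1.
  by rewrite geC0_conj// invr_ge0 sqrtC_ge0.
by rewrite mulrACA -invfM -expr2 sqrtCK mulrC.
Qed.

Fixpoint residual T (s : nat -> H) n :=
  if n is m.+1 then peel (residual T s m) (s m) else T.

Section Residuals.
Variables (X : H -> H) (s : nat -> H).
Hypotheses (X_linear : linear X) (X_pos : positive_operator dot X).

Lemma residual_linear n : linear (residual X s n).
Proof. by elim: n => [//|n IH]; apply: peel_linear. Qed.

Lemma residual_positive n : positive_operator dot (residual X s n).
Proof. by elim: n => [//|n IH]; apply: peel_positive => //; exact: residual_linear. Qed.

Lemma residual_kernel k n : (k < n)%N -> residual X s n (s k) = 0.
Proof.
elim: n => // n IH; rewrite ltnS leq_eqVlt => /predU1P[->|/IH h] /=.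
  by apply: peel_pivot; [exact: residual_linear | exact: residual_positive].
by apply: peel_kernel; [exact: residual_linear | exact: residual_positive |].
Qed.

Definition summand n := pivot_vector (residual X s n) (s n).

Lemma residualE n x y : dot (X x) y =
  \sum_(k < n) dot x (summand k) * dot (summand k) y + dot (residual X s n x) y.
Proof.
elim: n => [|n IH]; first by rewrite big_ord0 add0r.
rewrite IH big_ord_recr /= dot_peel dot_pivot_vector; last exact: residual_positive.
by ring.
Qed.

Lemma residual_decr m n x : (m <= n)%N ->
  dot (residual X s n x) x <= dot (residual X s m x) x.
Proof.
move=> /subnK <-; elim: (n - m)%N => // k IH; apply: le_trans IH.
rewrite addSn /= dot_peel -dot_pivot_vector; last exact: residual_positive.
rewrite gerBl [dot _ x]dotC -normCK; exact: exprn_ge0.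
Qed.

End Residuals.

(** The pivots run through the countably many basis vectors at which [X] has a
nonzero diagonal entry.  The residuals decrease and vanish eventually at each of
these, and the set of [x] with [<X_n x, x> -> 0] is a closed subspace, so it is
everything; Cauchy-Schwarz then gives weak convergence.  The bound on the norms
is obtained by computing [sum_k |w_k|^2] in the basis. *)
Theorem rank_one_series (X : H -> H) E (t : R[i]) : bounded_operator X ->
    positive_operator dot X -> orthonormal_basis dot E -> 0 <= t ->
    has_sum E (fun e => dot (X e) e) t ->
  exists w : nat -> H, (forall n, \sum_(k < n) `|w k| ^+ 2 <= t) /\
    forall x y, converges_to (fun n => \sum_(k < n) dot x (w k) * dot (w k) y)
      (dot (X x) y).
Proof.
move=> /bounded_operatorP[Xlin [M M0 hM]] Xpos Ebasis t0 sumX.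
have [s s_support] := has_sum_support Xpos sumX.
pose w := summand X s; exists w; split.
  move=> n; apply/ler_addgt0Pr => eps eps0.
  have eps1 : 0 < eps / n.+1%:R by rewrite divr_gt0// ltr0Sn.
  have d0 : 0 < sqrtC (eps / n.+1%:R) by rewrite sqrtC_gt0.
  have [F EF /(_ _ EF (@subset_refl _ F)) hF] :=
    proj_cvg_family dot_norm Ebasis w n d0.
  have [Ffin _] := EF.
  under eq_bigr do rewrite (proj_pythagoras dot_norm Ebasis _ EF) addrC.
  rewrite big_split /= lerD//.
    apply: le_trans (has_sum_ge t0 Xpos sumX EF).
    rewrite fsbig_finite//.
    apply: (@le_trans _ _ (\sum_(e <- finmap.enum_fset (fset_set F))
        \sum_(k < n) dot e (w k) * dot (w k) e)); last first.
      apply: ler_sum => e _; rewrite (residualE s Xlin Xpos n) lerDl.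
      exact: residual_positive.
    rewrite exchange_big; apply: ler_sum => k _ /=.
    rewrite (norm_proj_sqr dot_norm Ebasis)//.
    by rewrite dot_proj//; apply: ler_sum => e _; rewrite mulrC.
  apply: (@le_trans _ _ (\sum_(k < n) (eps / n.+1%:R))).
    apply: ler_sum => k _; rewrite -[leRHS]sqrtCK ler_sqr ?nnegrE ?(ltW d0)//.
    exact: hF.
  rewrite sumr_const card_ord -[leLHS]mulr_natr mulrAC ler_pdivrMr ?ltr0Sn//.
  by rewrite ler_wpM2l ?ler_nat// ltW.
have small x (eps : R[i]) : 0 < eps ->
    exists N, dot (residual X s N x) x <= eps.
  have [_ _ E_dense] := Ebasis; move: x eps.
  (* The parallelogram law, used in place of the triangle inequality. *)
  have para n x y : dot (residual X s n (x + y)) (x + y) <=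
      2 * dot (residual X s n x) x + 2 * dot (residual X s n y) y.
    have := residual_positive s Xlin Xpos n (x - y).
    have [f ->] := linear_operator (residual_linear s Xlin n).
    rewrite (linearB f) (linearD f) !dotE => h; rewrite -subr_ge0.
    by apply: le_trans h _; rewrite le_eqVlt; apply/orP; left; apply/eqP; ring.
  apply: (dense_span_ind (P := fun x => forall eps : R[i], 0 < eps -> _) E_dense).
  - move=> e Ee eps eps0; have [Xe0|Xe0] := eqVneq (dot (X e) e) 0.
      by exists 0; rewrite /= Xe0 ltW.
    have [k <-] := s_support e Ee (elimN eqP Xe0).
    by exists k.+1; rewrite residual_kernel// dot0l ltW.
  - split=> [eps eps0|c x y hx hy eps eps0].
      by exists 0 => /=; rewrite dot0r ltW.
    have c1 : 0 < 2 * (`|c| ^+ 2 + 1) by rewrite mulr_gt0// ltr_wpDl// exprn_ge0.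
    have [N1 h1] := hx (eps / 2 / (2 * (`|c| ^+ 2 + 1))) ltac:(by rewrite !divr_gt0).
    have [N2 h2] := hy (eps / 2 / 2) ltac:(by rewrite !divr_gt0).
    exists (maxn N1 N2); apply: le_trans (para _ _ _) _.
    rewrite [leRHS]splitr lerD//; last first.
      rewrite mulrC -ler_pdivlMr//; apply: le_trans h2.
      by apply: residual_decr => //; rewrite leq_maxr.
    have {}h1 := le_trans (residual_decr s Xlin Xpos x (leq_maxl N1 N2)) h1.
    have [f fE] := linear_operator (residual_linear s Xlin (maxn N1 N2)).
    move: h1; rewrite fE (linearZ_LR f) dotZl dotZr => h1.
    have -> : 2 * (c * (c^* * dot (f x) x)) = 2 * `|c| ^+ 2 * dot (f x) x.
      by rewrite normCK; ring.
    rewrite ler_pdivlMr// in h1; apply: le_trans h1; rewrite mulrC ler_wpM2l//.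
      by rewrite -fE; exact: residual_positive.
    by rewrite ler_wpM2l// lerDl.
  - move=> x hx eps eps0.
    have M1 : 0 < 2 * M + 1 by rewrite ltr_wpDl// mulr_ge0// ltW.
    have d0 : 0 < sqrtC (eps / 2 / (2 * M + 1)) by rewrite sqrtC_gt0 !divr_gt0.
    have [y hy xy] := hx _ d0.
    have [N hN] := hy (eps / 2 / 2) ltac:(by rewrite !divr_gt0).
    exists N; rewrite -(subrK y x); apply: le_trans (para _ _ _) _.
    rewrite [leRHS]splitr lerD//; last by rewrite mulrC -ler_pdivlMr.
    apply: (@le_trans _ _ (2 * (M * `|x - y| ^+ 2))).
      rewrite ler_pM2l//; apply: le_trans (residual_decr s Xlin Xpos _ (leq0n N)) _.
      rewrite /= -[dot _ _]ger0_norm ?Xpos// (le_trans (dot_le_norm dot_norm _ _))//.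
      by rewrite expr2 mulrA ler_wpM2r.
    apply: (@le_trans _ _ ((2 * M + 1) * `|x - y| ^+ 2)).
      by rewrite mulrA ler_wpM2r ?exprn_ge0// lerDl.
    rewrite mulrC -ler_pdivlMr// -[leRHS]sqrtCK ler_sqr ?nnegrE ?(ltW d0)//.
move=> x y eps eps0.
have y0 : 0 < dot (X y) y + 1 by rewrite ltr_wpDl ?Xpos.
have [N hN] := small x (eps ^+ 2 / (dot (X y) y + 1))
  ltac:(by rewrite divr_gt0 ?exprn_gt0).
exists N => n Nn; rewrite (residualE s Xlin Xpos n) opprD addrA subrr sub0r normrN.
rewrite -ler_sqr ?nnegrE ?(ltW eps0)//.
have [_] := positive_operator_form (residual_linear s Xlin n)
  (residual_positive s Xlin Xpos n) x y.
move/le_trans; apply.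
apply: (@le_trans _ _ (eps ^+ 2 / (dot (X y) y + 1) * (dot (X y) y + 1))).
  apply: ler_pM; try exact: residual_positive.
    exact: le_trans (residual_decr s Xlin Xpos x Nn) hN.
  apply: le_trans (residual_decr s Xlin Xpos y (leq0n n)) _ => /=.
  by rewrite lerDl.
by rewrite divfK ?gt_eqF.
Qed.

End RankOneSeries.

(** * The trace functional as a sum of vector functionals *)

Section TraceFormula.
Variables (R : realType) (H : completeNormedModType R[i]).
Variable dot : {dot H for Num.conj}.
Hypothesis dot_norm : norm_from_dot dot.
Variables (X : H -> H) (w : nat -> H) (t : R[i]).
Hypothesis w_summable : forall n, \sum_(k < n) `|w k| ^+ 2 <= t.
Hypothesis X_series : forall x y,
  converges_to (fun n => \sum_(k < n) dot x (w k) * dot (w k) y) (dot (X x) y).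

Lemma weighted_sum_le (M : R[i]) n : 0 < M ->
  \sum_(k < n) M * `|w k| ^+ 2 <= M * t.
Proof. by move=> M0; rewrite -mulr_sumr ler_pM2l. Qed.

Lemma vector_states_cvg (a : H -> H) : bounded_operator a ->
  exists l, converges_to (fun n => \sum_(k < n) dot (a (w k)) (w k)) l.
Proof.
move=> /bounded_operatorP[_ [M M0 hM]].
apply: (@complex_series_cvg _ (fun k => dot (a (w k)) (w k)) (M * t)) => n.
apply: le_trans (weighted_sum_le n M0); apply: ler_sum => k _.
by rewrite (le_trans (dot_le_norm dot_norm _ _))// expr2 mulrA ler_wpM2r.
Qed.

(** The sum over a finite part [F] of the basis is [sum_k <P_F a w_k, w_k>], with
[P_F] the projection onto the span of [F].  The difference with [l] is at most
[sum_k |a w_k - P_F a w_k| |w_k|], which is dominated by a multiple of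
[sum_k |w_k|^2] and tends to [0] term by term. *)
Lemma has_sum_vector_states (a a' : H -> H) (l : R[i]) E : bounded_operator a ->
    adjoint_of dot a a' -> orthonormal_basis dot E ->
    converges_to (fun n => \sum_(k < n) dot (a (w k)) (w k)) l ->
  has_sum E (fun e => dot ((a \o X) e) e) l.
Proof.
move=> /bounded_operatorP[alin [M M0 hM]] aa' Ebasis al eps eps0.
have e2 : 0 < eps / 2 by rewrite divr_gt0.
pose b k := M * `|w k| ^+ 2.
have b0 k : 0 <= b k by rewrite mulr_ge0 ?exprn_ge0// ltW.
have [N [d d0 dom]] := dominated_sum b0 (fun n => weighted_sum_le n M0) e2.
(* The factor turns the projection error of [v k] into the dominated quantity. *)
pose v k := `|w k| *: a (w k).
have [F0 EF0 hF0] := proj_cvg_family dot_norm Ebasis v N d0.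
exists F0 => // F EF F0F; have [Ffin _] := EF.
apply: (@le_lt_trans _ _ (eps / 2)); last first.
  by rewrite ltr_pdivrMr// ltr_pMr// ltr1n.
set s := \sum_(e \in F) _.
have sE : s = \sum_(e <- finmap.enum_fset (fset_set F)) dot (X e) (a' e).
  by rewrite /s fsbig_finite//; apply: eq_bigr => e _; rewrite /= aa'.
have proj_cvg_s :
    converges_to (fun n => \sum_(k < n) dot (proj dot F (a (w k))) (w k)) s.
  rewrite sE; have -> : (fun n => \sum_(k < n) dot (proj dot F (a (w k))) (w k)) =
      (fun n => \sum_(e <- finmap.enum_fset (fset_set F))
                \sum_(k < n) dot e (w k) * dot (w k) (a' e)).
    apply/funext => n; rewrite exchange_big; apply: eq_bigr => k _.
    by rewrite dot_proj//; apply: eq_bigr => e _; rewrite aa' mulrC.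
  by apply: converges_to_sum => e; exact: X_series.
have := converges_to_linear (-1) al proj_cvg_s.
rewrite mulN1r addrC => /converges_to_norm_le; apply => n.
rewrite mulN1r addrC -sumrB (le_trans (ler_norm_sum _ _ _))//.
apply: (@le_trans _ _ (\sum_(k < n) `|v k - proj dot F (v k)|)).
  apply: ler_sum => k _; rewrite distrC -dotBl.
  have [f fE] := linear_operator (proj_linear dot Ffin).
  rewrite fE (linearZ_LR f) -scalerBr normrZ normr_id mulrC.
  exact: dot_le_norm.
apply: (dom (fun k => `|v k - proj dot F (v k)|)) => k; last by move=> kN; exact: hF0.
rewrite normr_ge0 (le_trans (norm_sub_proj_le dot_norm Ebasis _ EF))//.
by rewrite normrZ normr_id /b expr2 mulrCA ler_wpM2l.
Qed.

(** The sum [l] is the same in every basis, so the trace of [a X] is defined by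
it; the one basis [E] shows that no other value qualifies. *)
Lemma trace_functional_cvg (a a' : H -> H) E : bounded_operator a ->
    adjoint_of dot a a' -> orthonormal_basis dot E ->
  converges_to (fun n => \sum_(k < n) dot (a (w k)) (w k))
    (trace_functional dot X a).
Proof.
move=> abounded aa' Ebasis; have [l al] := vector_states_cvg abounded.
suff -> : trace_functional dot X a = l by [].
have /= hl F : orthonormal_basis dot F -> _ := fun FB =>
  has_sum_vector_states abounded aa' FB al.
have : [set s | forall F, orthonormal_basis dot F ->
                 has_sum F (fun e => dot ((a \o X) e) e) s] l by exact: hl.
by move=> /(xgetI 0)/(_ _ Ebasis) tl; apply: has_sum_unique tl (hl _ Ebasis).
Qed.

End TraceFormula.

(** * Contractions equal to the identity modulo the ideal *)

Section Cutoffs.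
Variables (R : realType) (H : completeNormedModType R[i]).
Variable dot : {dot H for Num.conj}.
Hypothesis dot_norm : norm_from_dot dot.
Variables (A J : set (H -> H)).
Hypothesis A_cstar : unital_cstar_algebra dot A.
Hypothesis J_ideal : closed_two_sided_ideal A J.
Hypothesis J_nondeg : nondegenerate_on J.
Implicit Types (g T S : H -> H).

(** The complement of a contractive approximate unit: [1 - g] is in the ideal,
and [g] will be small at prescribed vectors. *)
Definition cutoff g : Prop :=
  [/\ J (idfun - g), linear g & forall x, `|g x| <= `|x|].

Lemma idealZ (c : R[i]) T : J T -> J (c *: T).
Proof.
have [_ [J0 Jsub] _ _] := J_ideal => JT.
by rewrite -[c *: T]addr0; apply: Jsub.
Qed.

Lemma idealD T S : J T -> J S -> J (T + S).
Proof.
have [_ [J0 Jsub] _ _] := J_ideal => JT JS.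
by rewrite -[T]scale1r; apply: Jsub.
Qed.

Lemma cutoff_in_algebra g : cutoff g -> A g.
Proof.
have [_ [[A0 Asub] A1] _ _ _] := A_cstar; have [JA _ _ _] := J_ideal.
move=> [Jg _ _]; have -> : g = (-1 : R[i]) *: (idfun - g) + idfun.
  by rewrite scaleN1r opprB subrK.
by apply: Asub => //; apply: JA.
Qed.

Lemma cutoff_id : cutoff idfun.
Proof. by have [_ [J0 _] _ _] := J_ideal; split => //; rewrite subrr. Qed.

Lemma cutoff_comp g1 g2 : cutoff g1 -> cutoff g2 -> cutoff (g1 \o g2).
Proof.
move=> [J1 lin1 h1] cut2; have [J2 lin2 h2] := cut2.
have [_ _ Jmul _] := J_ideal.
split; last by move=> x; rewrite (le_trans (h1 _)).
  have -> : idfun - (g1 \o g2) = (idfun - g2) + ((idfun - g1) \o g2).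
    by apply/funext => x /=; rewrite !fctE /= subrKA.
  by apply: idealD => //; have [] := Jmul _ _ (cutoff_in_algebra cut2) J1.
by move=> a x y /=; rewrite lin2 lin1.
Qed.

(** With [c = M^2] one has [0 <= V U <= c], hence
[(1 - V U / c)^2 <= 1 - V U / c]; the conclusion is this inequality at [x]. *)
Lemma norm_damping (U V : H -> H) (M : R[i]) x : adjoint_of dot U V -> 0 < M ->
    (forall z, `|V z| <= M * `|z|) ->
  `|x - (M ^+ 2)^-1 *: V (U x)| ^+ 2 <= `|x| ^+ 2 - (M ^+ 2)^-1 * `|U x| ^+ 2.
Proof.
move=> UV M0 hV; have VU := adjoint_sym UV.
have M2 : 0 < M ^+ 2 by rewrite exprn_gt0.
have rC : ((M ^+ 2)^-1)^* = (M ^+ 2)^-1 by rewrite geC0_conj// invr_ge0 ltW.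
rewrite dot_norm !dotE rC.
have -> : dot (V (U x)) x = `|U x| ^+ 2 by rewrite VU dot_norm.
have -> : dot x (V (U x)) = `|U x| ^+ 2 by rewrite -UV dot_norm.
rewrite -!dot_norm -addrA lerD2l.
have : (M ^+ 2)^-1 * `|V (U x)| ^+ 2 <= `|U x| ^+ 2.
  by rewrite mulrC ler_pdivrMr// mulrC -exprMn ler_sqr ?nnegrE ?mulr_ge0 ?(ltW M0)// hV.
move/(ler_wpM2l (_ : 0 <= (M ^+ 2)^-1)) => /(_ ltac:(by rewrite invr_ge0 ltW)).
rewrite -subr_ge0 => /le_trans h; rewrite -subr_ge0; apply: h.
by rewrite le_eqVlt; apply/orP; left; apply/eqP; ring.
Qed.

(** Let [C = 1 - T T^* / c] and [D = 1 - T^* T / c] with [c = M^2], where [M] bounds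
[T].  The loss of norm from [D^m y] to [D^(m+1) y] controls [|T D^m y|^2], so these
are summable over [m] and one of them is small; moreover [C^m T = T D^m]. *)
Lemma cutoff_range T y (eps : R[i]) : J T -> 0 < eps ->
  exists2 g, cutoff g & `|g (T y)| <= eps.
Proof.
have [Abounded [[A0 Asub] A1] _ Aadj _] := A_cstar.
have [JA _ Jmul _] := J_ideal.
move=> JT eps0; have AT := JA _ JT; have [T' AT' TT'] := Aadj _ AT.
have [Tlin [M M0 hT]] := bounded_operatorP (Abounded _ AT).
have [T'lin _] := bounded_operatorP (Abounded _ AT').
have hT' := adjoint_bound dot_norm TT' M0 hT; have T'T := adjoint_sym TT'.
have [f fE] := linear_operator Tlin; have [f' f'E] := linear_operator T'lin.
have M2 : 0 < M ^+ 2 by rewrite exprn_gt0.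
pose C x := x - (M ^+ 2)^-1 *: T (T' x).
pose D x := x - (M ^+ 2)^-1 *: T' (T x).
have C_cut : cutoff C.
  split.
  - have -> : idfun - C = (M ^+ 2)^-1 *: (T \o T').
      by apply/funext => x; rewrite !fctE /C /= opprB addrC subrK.
    by apply: idealZ; have [] := Jmul _ _ AT' JT.
  - move=> a u v; rewrite /C fE f'E (linearP f') (linearP f) scalerDr opprD addrACA.
    by rewrite scalerBr !scalerA [a * _]mulrC.
  move=> x; rewrite -ler_sqr ?nnegrE//.
  rewrite (le_trans (norm_damping x T'T M0 hT))// gerBl.
  by rewrite mulr_ge0 ?exprn_ge0// invr_ge0 ltW.
have CT m : iter m C (T y) = T (iter m D y).
  by elim: m => // m /= ->; rewrite /C /D fE (linearB f) (linearZ_LR f).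
have Dsum n : \sum_(m < n) `|T (iter m D y)| ^+ 2 <= M ^+ 2 * `|y| ^+ 2.
  rewrite -ler_pdivrMl// mulr_sumr.
  apply: (@le_trans _ _ (`|y| ^+ 2 - `|iter n D y| ^+ 2)); last first.
    by rewrite gerBl exprn_ge0.
  elim: n => [|n IH]; first by rewrite big_ord0 subrr.
  rewrite big_ord_recr /=; apply: le_trans (lerD IH (lexx _)) _.
  by rewrite -addrA lerD2l -lerN2 opprD !opprK; exact: norm_damping TT' M0 hT'.
have [m hm] := small_term (fun m => exprn_ge0 2 (normr_ge0 (T (iter m D y)))) Dsum
  (exprn_gt0 2 eps0).
exists (iter m C); last by rewrite CT -ler_sqr ?nnegrE// ltW.
by elim: m {hm} => [|m IH]; [exact: cutoff_id | exact: (cutoff_comp C_cut IH)].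
Qed.

(** The statement is relative to an earlier cutoff [g0] so that vectors can be
treated one after the other: a later cutoff, being a contraction, does not
spoil what the earlier ones achieved. *)
Lemma cutoff_vector x (eps : R[i]) g0 : 0 < eps -> cutoff g0 ->
  exists2 g, cutoff g & `|g (g0 x)| <= eps.
Proof.
have [_ _ Jmul _] := J_ideal.
move=> eps0 cut0; move: x eps eps0 g0 cut0.
apply: (dense_span_ind (P := fun x => forall eps : R[i], 0 < eps ->
  forall g0, cutoff g0 -> exists2 g, cutoff g & `|g (g0 x)| <= eps) J_nondeg).
- move=> _ [T [y [JT ->]]] eps eps0 g0 cut0.
  apply: (@cutoff_range (g0 \o T)) => //.
  by have [] := Jmul _ _ (cutoff_in_algebra cut0) JT.
- split=> [eps eps0 g0 [_ lin0 _]|c x y hx hy eps eps0 g0 cut0].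
    exists idfun; first exact: cutoff_id.
    by have [f ->] := linear_operator lin0; rewrite (linear0 f) normr0 ltW.
  have c1 : 0 < `|c| + 1 by rewrite ltr_wpDl.
  have [g1 cut1 h1] := hx (eps / 2 / (`|c| + 1)) ltac:(by rewrite !divr_gt0) _ cut0.
  have [g2 cut2 h2] := hy (eps / 2) ltac:(by rewrite divr_gt0) _ (cutoff_comp cut1 cut0).
  exists (g2 \o g1); first exact: cutoff_comp.
  have [_ lin0 _] := cut0; have [_ lin1 _] := cut1; have [_ lin2 con2] := cut2.
  rewrite /= lin0 lin1 lin2 [leRHS]splitr (le_trans (ler_normD _ _))// lerD//.
  rewrite normrZ (le_trans (ler_wpM2l _ (le_trans (con2 _) h1)))//.
  rewrite mulrCA ler_piMr ?divr_ge0 ?(ltW eps0)//.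
  by rewrite ler_pdivrMr// mul1r lerDl.
- move=> x hx eps eps0 g0 cut0; have e2 : 0 < eps / 2 by rewrite divr_gt0.
  have [y hy xy] := hx _ e2; have [g cutg hg] := hy _ e2 _ cut0.
  exists g => //; have [_ lin con] := cutoff_comp cutg cut0.
  have [f fE] := linear_operator lin.
  rewrite -[g (g0 x)]/((g \o g0) x) -(subrK y x) fE (linearD f) -fE.
  rewrite (le_trans (ler_normD _ _))// [leRHS]splitr lerD//.
  by rewrite (le_trans (con _)).
Qed.

Lemma cutoff_family (v : nat -> H) N (eps : R[i]) : 0 < eps ->
  exists2 g, cutoff g & forall k, (k < N)%N -> `|g (v k)| <= eps.
Proof.
move=> eps0; elim: N => [|N [g0 cut0 h0]]; first by exists idfun => //; exact: cutoff_id.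
have [g cutg hg] := cutoff_vector (v N) eps0 cut0.
exists (g \o g0) => [|k]; first exact: cutoff_comp.
rewrite ltnS leq_eqVlt => /predU1P[->//|/h0 h] /=.
by have [_ _ con] := cutg; rewrite (le_trans (con _)).
Qed.

Lemma cutoff_summable (w : nat -> H) (t eps : R[i]) :
    (forall n, \sum_(k < n) `|w k| ^+ 2 <= t) -> 0 < eps ->
  exists2 g, cutoff g & forall n, \sum_(k < n) `|g (w k)| ^+ 2 <= eps.
Proof.
move=> wt eps0.
have [N [d d0 dom]] := dominated_sum (fun k => exprn_ge0 2 (normr_ge0 (w k))) wt eps0.
have sd0 : 0 < sqrtC d by rewrite sqrtC_gt0.
have [g cutg hg] := cutoff_family w N sd0; have [_ _ con] := cutg.
exists g => //; apply: (dom (fun k => `|g (w k)| ^+ 2)) => k.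
  by rewrite exprn_ge0//= ler_sqr ?nnegrE.
by move=> kN; rewrite -[leRHS]sqrtCK ler_sqr ?nnegrE ?(ltW sd0)// hg.
Qed.

End Cutoffs.

(** * Positive functionals *)

Section PositiveFunctionals.
Variables (R : realType) (H : completeNormedModType R[i]).
Variable dot : {dot H for Num.conj}.
Variable A : set (H -> H).
Hypothesis A_cstar : unital_cstar_algebra dot A.
Variable phi : (H -> H) -> R[i].
Hypothesis phi_pos : positive_functional dot A phi.
Implicit Types (S T : H -> H).

Lemma algebraD S T : A S -> A T -> A (S + T).
Proof.
have [_ [[_ Asub] _] _ _ _] := A_cstar => AS AT.
by rewrite -[S]scale1r; apply: Asub.
Qed.

Lemma algebraZ (c : R[i]) T : A T -> A (c *: T).
Proof.
have [_ [[A0 Asub] _] _ _ _] := A_cstar => AT.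
by rewrite -[c *: T]addr0; apply: Asub.
Qed.

Lemma functional0 : phi 0 = 0.
Proof.
have [_ [[A0 _] _] _ _ _] := A_cstar; have [lin _] := phi_pos.
have := lin 1 0 0 A0 A0; rewrite scaler0 addr0 mul1r => h.
by apply: (addrI (phi 0)); rewrite addr0 -h.
Qed.

Lemma functionalD S T : A S -> A T -> phi (S + T) = phi S + phi T.
Proof.
have [lin _] := phi_pos => AS AT.
by rewrite -[S in LHS]scale1r lin// mul1r.
Qed.

Lemma functionalZ (c : R[i]) T : A T -> phi (c *: T) = c * phi T.
Proof.
have [_ [[A0 _] _] _ _ _] := A_cstar; have [lin _] := phi_pos => AT.
by rewrite -[c *: T]addr0 lin// functional0 addr0.
Qed.

(** The form [(S, T) |-> phi (S^* T)] is hermitian and satisfies Cauchy-Schwarz: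
expand [0 <= phi ((c T + S)^* (c T + S))]. *)
Lemma functional_form S S' T T' : A S -> A S' -> A T -> A T' ->
    adjoint_of dot S S' -> adjoint_of dot T T' ->
  phi (T' \o S) = (phi (S' \o T))^* /\
    `|phi (S' \o T)| ^+ 2 <= phi (S' \o S) * phi (T' \o T).
Proof.
have [Abounded _ Amul _ _] := A_cstar; have [_ pos] := phi_pos.
move=> AS AS' AT AT' SS' TT'.
apply: ge0_sesquilinear; [exact: pos | exact: pos | move=> c].
have adj : adjoint_of dot (c *: T + S) (c^* *: T' + S').
  by move=> x y; rewrite !fctE !dotE conjCK SS' TT'.
have := pos _ _ (algebraD (algebraZ c AT) AS) (algebraD (algebraZ c^* AT') AS') adj.
have [/linear_operator[f f'E] _] := Abounded _ AS'.
have [/linear_operator[g g'E] _] := Abounded _ AT'.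
have -> : (c^* *: T' + S') \o (c *: T + S) =
    (`|c| ^+ 2) *: (T' \o T) + (c^* *: (T' \o S) + (c *: (S' \o T) + (S' \o S))).
  apply/funext => x; rewrite !fctE /= f'E g'E.
  rewrite (linearD f) (linearD g) (linearZ_LR f) (linearZ_LR g) normCK.
  by rewrite scalerDr scalerA [c^* * c]mulrC !addrA.
have ATT := Amul _ _ AT' AT; have ATS := Amul _ _ AT' AS.
have AST := Amul _ _ AS' AT; have ASS := Amul _ _ AS' AS.
have A1 := algebraD (algebraZ c AST) ASS.
have A2 := algebraD (algebraZ c^* ATS) A1.
rewrite (functionalD (algebraZ _ ATT) A2) (functionalD (algebraZ _ ATS) A1).
rewrite (functionalD (algebraZ _ AST) ASS) !functionalZ//.
move=> /le_trans; apply.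
by rewrite le_eqVlt; apply/orP; left; apply/eqP; ring.
Qed.

End PositiveFunctionals.

(** * Uniqueness of the extension *)

Section UniqueExtension.
Variables (R : realType) (H : completeNormedModType R[i]).
Variable dot : {dot H for Num.conj}.
Variables (A J : set (H -> H)).
Hypothesis A_cstar : unital_cstar_algebra dot A.
Hypothesis J_ideal : closed_two_sided_ideal A J.
Variables phi tau : (H -> H) -> R[i].
Hypothesis phi_pos : positive_functional dot A phi.
Hypothesis tau_pos : positive_functional dot A tau.
Hypothesis phi_tau : forall a, plus_scalars J a -> phi a = tau a.

Lemma agree_on_ideal T : J T -> phi T = tau T.
Proof. by move=> JT; apply: phi_tau; exists T, 0; rewrite scale0r addr0. Qed.

Lemma agree_on_cutoff g : cutoff J g -> phi g = tau g.
Proof.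
move=> [Jg _ _]; apply: phi_tau; exists ((-1 : R[i]) *: (idfun - g)), 1.
split; first exact: idealZ J_ideal _ _ Jg.
by rewrite scale1r scaleN1r opprB subrK.
Qed.

(** From [g' g = g' - g' (1 - g)]: the last term is in [J], and the values at [g']
are conjugate to those at [g], which is in [J + C 1]. *)
Lemma agree_on_cutoff_square g g' : cutoff J g -> A g' -> adjoint_of dot g g' ->
  phi (g' \o g) = tau (g' \o g).
Proof.
move=> gcut Ag' gg'; have [_ [_ A1] Amul _ _] := A_cstar.
have [JA _ Jmul _] := J_ideal; have [Jg _ _] := gcut.
have Ag := cutoff_in_algebra A_cstar J_ideal gcut.
have idadj : adjoint_of dot idfun idfun by [].
have Jj : J (g' \o (idfun - g)) by have [] := Jmul _ _ Ag' Jg.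
have -> : g' \o g = (-1 : R[i]) *: (g' \o (idfun - g)) + g'.
  have [Abounded _ _ _ _] := A_cstar.
  have [/linear_operator[f ->] _] := Abounded _ Ag'.
  by apply/funext => x; rewrite !fctE /= (linearB f) scaleN1r opprB subrK.
have [herm_phi _] := functional_form A_cstar phi_pos A1 A1 Ag Ag' idadj gg'.
have [herm_tau _] := functional_form A_cstar tau_pos A1 A1 Ag Ag' idadj gg'.
have AZ : A ((-1 : R[i]) *: (g' \o (idfun - g))).
  by apply: (algebraZ A_cstar); exact: JA.
rewrite (functionalD phi_pos)// (functionalD tau_pos)//.
rewrite (functionalZ A_cstar phi_pos); last exact: JA.
rewrite (functionalZ A_cstar tau_pos); last exact: JA.
rewrite (agree_on_ideal Jj); congr (_ + _).
exact: etrans herm_phi (etrans (congr1 _ (agree_on_cutoff gcut)) (esym herm_tau)).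
Qed.

(** Split [a = a (1 - g) + a g].  The functionals agree at the first term, and
Cauchy-Schwarz bounds both at the second by the common value at [g' g]. *)
Lemma extension_unique_of_cutoffs :
    (forall eps : R[i], 0 < eps -> exists g g', [/\ cutoff J g, A g',
       adjoint_of dot g g' & tau (g' \o g) <= eps]) ->
  forall a, A a -> phi a = tau a.
Proof.
move=> small a Aa; have [Abounded [_ A1] Amul Aadj _] := A_cstar.
have [JA _ Jmul _] := J_ideal.
have [a' Aa' aa'] := Aadj _ Aa; have a'a := adjoint_sym aa'.
have [_ pos1] := phi_pos; have [_ pos2] := tau_pos.
have K1 := pos1 _ _ Aa' Aa a'a; have K2 := pos2 _ _ Aa' Aa a'a.
apply: eq_of_dist_le => eps eps0.
set K := 2 * (phi (a \o a') + tau (a \o a')) + 1.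
have K0 : 0 < K by rewrite ltr_wpDl// mulr_ge0// addr_ge0.
have [g [g' [gcut Ag' gg' gsmall]]] := small (eps ^+ 2 / K)
  ltac:(by rewrite divr_gt0// exprn_gt0).
have Ag := cutoff_in_algebra A_cstar J_ideal gcut; have [Jg _ _] := gcut.
have Jaj : J (a \o (idfun - g)) by have [] := Jmul _ _ Aa Jg.
have Aag : A (a \o g) by exact: Amul.
have -> : a = (a \o (idfun - g)) + (a \o g).
  have [/linear_operator[f ->] _] := Abounded _ Aa.
  by apply/funext => x; rewrite !fctE /= (linearB f) subrK.
have Aaj := JA _ Jaj.
rewrite (functionalD phi_pos)// (functionalD tau_pos)//.
rewrite (agree_on_ideal Jaj) opprD addrACA subrr add0r.
have [_ cs1] := functional_form A_cstar phi_pos Aa' Aa Ag Ag' a'a gg'.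
have [_ cs2] := functional_form A_cstar tau_pos Aa' Aa Ag Ag' a'a gg'.
rewrite (agree_on_cutoff_square gcut Ag' gg') in cs1.
rewrite -ler_sqr ?nnegrE ?(ltW eps0)//.
set p := phi (a \o g) in cs1 *; set q := tau (a \o g) in cs2 *.
apply: (@le_trans _ _ (2 * (`|p| ^+ 2 + `|q| ^+ 2))).
  (* The difference of the two sides is [|p + q|^2]. *)
  rewrite -subr_ge0; apply: le_trans (exprn_ge0 2 (normr_ge0 (p + q))) _.
  rewrite !normCK !(rmorphD, rmorphN) /=.
  by rewrite le_eqVlt; apply/orP; left; apply/eqP; ring.
apply: (@le_trans _ _ (K * tau (g' \o g))).
  apply: le_trans (ler_wpM2l _ (lerD cs1 cs2)) _ => //.
  rewrite -mulrDl mulrA ler_wpM2r ?lerDl// pos2//.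
by rewrite mulrC -ler_pdivlMr.
Qed.

End UniqueExtension.

Theorem corollary4p4
    (R : realType) (H : completeNormedModType R[i])
    (dot : {dot H for Num.conj}) (dot_norm : norm_from_dot dot)
    (A J : set (H -> H))
    (A_cstar : unital_cstar_algebra dot A)
    (J_ideal : closed_two_sided_ideal A J)
    (J_nondeg : nondegenerate_on J)
    (X : H -> H)
    (X_bounded : bounded_operator X)
    (X_pos : positive_operator dot X)
    (X_tc : trace_class dot X)
    (X_tr1 : trace dot X = 1) :
  unique_extension_property dot A (plus_scalars J) (trace_functional dot X).
Proof.
have [_ [_ [E [_ Ebasis _]]]] := X_tc.
have [Abounded [_ A1] Amul Aadj _] := A_cstar.
(* The trace is [1 <> 0], so it is not the default value of its definition. *)
have sumX : has_sum E (fun e => dot (X e) e) 1.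
  rewrite -X_tr1 /trace; case: xgetP => [s _ /(_ _ Ebasis) //|].
  move=> X0; exfalso; move: X_tr1; rewrite /trace; case: xgetP => [s _ Xs _|_ /eqP].
    exact: X0 Xs.
  by rewrite eq_sym oner_eq0.
have [w [w_summable X_series]] :=
  rank_one_series dot_norm X_bounded X_pos Ebasis ler01 sumX.
set tau := trace_functional dot X.
have tauE a : A a ->
    converges_to (fun n => \sum_(k < n) dot (a (w k)) (w k)) (tau a).
  move=> Aa; have [a' _ aa'] := Aadj _ Aa.
  exact (trace_functional_cvg dot_norm w_summable X_series (Abounded _ Aa) aa' Ebasis).
have tau_pos : positive_functional dot A tau.
  split=> [c S T AS AT|T S AT AS TS].
    have AcST : A (c *: S + T).
      by apply: (algebraD A_cstar) => //; apply: (algebraZ A_cstar).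
    apply: converges_to_unique (tauE _ AcST) _.
    have := converges_to_linear c (tauE _ AS) (tauE _ AT).
    suff -> : (fun n => c * \sum_(k < n) dot (S (w k)) (w k) +
          \sum_(k < n) dot (T (w k)) (w k)) =
        (fun n => \sum_(k < n) dot ((c *: S + T) (w k)) (w k)) by [].
    apply/funext => n; rewrite mulr_sumr -big_split.
    by apply: eq_bigr => k _; rewrite /= !fctE !dotE.
  apply: converges_to_ge0 (tauE _ (Amul _ _ AS AT)) _ => n.
  apply: sumr_ge0 => k _ /=.
  by rewrite (adjoint_sym TS) -dot_norm exprn_ge0.
split; first by split=> //; exact: X_tr1.
move=> phi phi_pos phi_tau.
apply: (extension_unique_of_cutoffs A_cstar J_ideal phi_pos tau_pos phi_tau).
move=> eps eps0.
have [g gcut gsmall] :=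
  cutoff_summable dot_norm A_cstar J_ideal J_nondeg w_summable eps0.
have Ag := cutoff_in_algebra A_cstar J_ideal gcut.
have [g' Ag' gg'] := Aadj _ Ag; exists g, g'; split=> //.
have tau_ge0 : 0 <= tau (g' \o g) by apply: (proj2 tau_pos).
rewrite -(ger0_norm tau_ge0).
apply: converges_to_norm_le (tauE _ (Amul _ _ Ag' Ag)) _ => n.
have -> : \sum_(k < n) dot ((g' \o g) (w k)) (w k) = \sum_(k < n) `|g (w k)| ^+ 2.
  by apply: eq_bigr => k _; rewrite /= (adjoint_sym gg') -dot_norm.
by rewrite ger0_norm// sumr_ge0// => k _; exact: exprn_ge0.
Qed.
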